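(* Let $f$ be a probability density on $\mathbb{R}^k$, let $\phi:\mathbb{R}^k\to\mathbb{R}$ be such that $I=\int \phi(x)f(x)\,dx$ is a well-defined finite integral, and let $T:\mathbb{R}^k\to\mathbb{R}^p$ and $h:\mathbb{R}^k\to\mathbb{R}_+$ define the exponential family $f_\theta(x)=\exp(\theta^T T(x)-A(\theta))h(x)$ with natural parameter $\theta$, where $h(x)>0$ whenever $\phi(x)f(x)\neq 0$. Let $\Theta\subseteq\mathbb{R}^p$ be any convex set. Then the per-sample variance $V:\mathbb{R}^p\to\mathbb{R}\cup\{\infty\}$ of the importance sampling estimator, $$V(\theta)=\int \frac{\phi^2(x)f^2(x)}{f_\theta(x)}\,dx-I^2$$ (with $V(\theta)=\infty$ when $A(\theta)=\infty$), is a convex function of $\theta$; that is, $$V(\eta\theta_1+(1-\eta)\theta_2)\le \eta V(\theta_1)+(1-\eta)V(\theta_2)$$ for all $\eta\in[0,1]$ and all $\theta_1,\theta_2\in\Theta$.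
   Context: All functions ($f$, $\phi$, $T$, $h$) are Borel measurable and integrals are with respect to Lebesgue measure on $\mathbb{R}^k$. $\mathbb{R}_+$ denotes the nonnegative reals. The log-normalizer $A:\mathbb{R}^p\to\mathbb{R}\cup\{\infty\}$ is $$A(\theta)=\log\int \exp(\theta^T T(x))h(x)\,dx;$$ in particular $A$ never takes the value $-\infty$, i.e. $h$ is not zero almost everywhere. When $A(\theta)=\infty$ one sets $f_\theta=0$ (this does not define a distribution) and $V(\theta)=\infty$. The integrand $\phi^2f^2/f_\theta$ is taken to be $0$ at points where $\phi(x)f(x)=0$. When $A(\theta)<\infty$, $V(\theta)=\mathrm{Var}_{X\sim f_\theta}\left[\phi(X)f(X)/f_\theta(X)\right]$, which may be $+\infty$. The usual conventions $0\cdot\infty=0$ and $\infty\le\infty$ are used in the convexity inequality. *)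

(* Defs.v *)
From HB Require Import structures.
From mathcomp Require Import all_boot all_order all_algebra.
From mathcomp Require Import all_classical all_reals all_analysis.
Import Order.TTheory GRing.Theory Num.Theory.
Import numFieldNormedType.Exports.
Set Implicit Arguments.
Unset Strict Implicit.
Unset Printing Implicit Defensive.
Local Open Scope classical_set_scope.
Local Open Scope ring_scope.

(* The measurable space R^k: tuples carry the sigma-algebra generated by their
   coordinates, which is the Borel sigma-algebra of R^k.  [measurableTypeR R]
   is [R] with its Borel sets, the type over which [lebesgue_measure] lives. *)
Notation Rn R k := (k.-tuple (measurableTypeR R)).

Section lebesgue_measure_Rn.
Context {R : realType}.
Local Open Scope ereal_scope.

Let Rn_cons n (z : measurableTypeR R * Rn R n) : Rn R n.+1 :=
  [the n.+1.-tuple _ of z.1 :: z.2].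

Let Rn_uncons n (t : Rn R n.+1) : measurableTypeR R * Rn R n :=
  (thead t, [tuple of behead t]).

(* The unit mass on the one-point space R^0, then the product measure on
   R * R^n, transported to R^(n+1); see [lebesgue_measure_Rn_box]. *)
Fixpoint lebesgue_measure_Rn (n : nat) : set (Rn R n) -> \bar R :=
  match n with
  | 0%N => dirac [tuple]
  | m.+1 => pushforward (lebesgue_measure \x @lebesgue_measure_Rn m)
              (@Rn_cons m)
  end.

Let measurable_Rn_cons n : measurable_fun setT (@Rn_cons n).
Proof. exact: measurable_cons. Qed.

Let measurable_Rn_uncons n : measurable_fun setT (@Rn_uncons n).
Proof.
apply/measurable_fun_pairP; split; first exact: measurable_tnth.
exact: measurable_behead.
Qed.

Let Rn_consK n : cancel (@Rn_cons n) (@Rn_uncons n).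
Proof. by move=> [x t]; congr pair; exact/val_inj. Qed.

Let sigma_finite_prod d1 d2 (T1 : measurableType d1) (T2 : measurableType d2)
    (m1 : {sigma_finite_measure set T1 -> \bar R})
    (m2 : {sigma_finite_measure set T2 -> \bar R}) :
  sigma_finite setT (m1 \x m2).
Proof.
have /sigma_finiteP[F [TF ndF Foo]] := sigma_finiteT m1.
have /sigma_finiteP[G [TG ndG Goo]] := sigma_finiteT m2.
exists (fun n => F n `*` G n).
  rewrite -setXTT TF TG; apply/seteqP; split => -[x y] /=.
    move=> [[n _ Fnx] [k _ Gky]]; exists (maxn n k) => //; split.
    - by move: x Fnx; exact/subsetPset/ndF/leq_maxl.
    - by move: y Gky; exact/subsetPset/ndG/leq_maxr.
  by move=> [n _ []/= ? ?]; split; exists n.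
move=> k; have [? ?] := Foo k; have [? ?] := Goo k.
split; first exact: measurableX.
by rewrite product_measure1E// lte_mul_pinfty// ge0_fin_numE.
Qed.

(* Packaging that lets the measure axioms below be read off from the library's
   instances on products and pushforwards. *)
Let measure_Rn_ex n :
  exists m : {sigma_finite_measure set (Rn R n) -> \bar R},
    @lebesgue_measure_Rn n = m.
Proof.
elim: n => [|n [m mE]].
  by exists (dirac [tuple] : {sigma_finite_measure set _ -> \bar R}).
pose nu : {measure set (measurableTypeR R * Rn R n)%type -> \bar R} :=
  lebesgue_measure \x m.
pose mu := pushforward nu (@Rn_cons n).
have mu0 : mu set0 = 0 by rewrite /mu /pushforward preimage_set0 measure0.
have mu_ge0 A : 0 <= mu A by exact: (measure_ge0 nu).
have mu_sa : semi_sigma_additive mu.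
  exact: (@measure_semi_sigma_additive _ _ _
    (measure_function_pushforward__canonical__measure_function_Measure nu
      (@measurable_Rn_cons n))).
have mu_sf : sigma_finite setT mu.
  have [F FT Ffin] := sigma_finite_prod (@lebesgue_measure R) m.
  exists (fun i => @Rn_uncons n @^-1` F i).
    by rewrite -preimage_bigcup -FT preimage_setT.
  move=> i; have [mF Foo] := Ffin i; split.
    by rewrite -[X in measurable X]setTI; exact: measurable_Rn_uncons.
  rewrite /mu /pushforward -comp_preimage.
  rewrite (_ : _ \o _ = id) ?preimage_id//.
  by apply/funext => z /=; exact: Rn_consK.
rewrite /= mE -/mu; clearbody mu; clear -mu0 mu_ge0 mu_sa mu_sf.
pose mu_m : {measure set (Rn R n.+1) -> \bar R} :=
  HB.pack mu (isMeasure.Build _ _ _ mu mu0 mu_ge0 mu_sa).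
pose mu_s : {sigma_finite_measure set (Rn R n.+1) -> \bar R} :=
  HB.pack (Measure.sort mu_m) (Measure_isSigmaFinite.Build _ _ _ mu_m mu_sf).
by exists mu_s.
Qed.

Let lebesgue_measure_Rn0 n : @lebesgue_measure_Rn n set0 = 0.
Proof. by have [m ->] := measure_Rn_ex n; rewrite measure0. Qed.

Let lebesgue_measure_Rn_ge0 n A : 0 <= @lebesgue_measure_Rn n A.
Proof. by have [m ->] := measure_Rn_ex n; rewrite measure_ge0. Qed.

Let lebesgue_measure_Rn_sigma_additive n :
  semi_sigma_additive (@lebesgue_measure_Rn n).
Proof.
by have [m ->] := measure_Rn_ex n; exact: measure_semi_sigma_additive.
Qed.

Let lebesgue_measure_Rn_sigma_finite n :
  sigma_finite setT (@lebesgue_measure_Rn n).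
Proof. by have [m ->] := measure_Rn_ex n; exact: sigma_finiteT. Qed.

HB.instance Definition _ n := isMeasure.Build _ _ _ (@lebesgue_measure_Rn n)
  (@lebesgue_measure_Rn0 n) (@lebesgue_measure_Rn_ge0 n)
  (@lebesgue_measure_Rn_sigma_additive n).

HB.instance Definition _ n := Measure_isSigmaFinite.Build _ _ _
  (@lebesgue_measure_Rn n) (@lebesgue_measure_Rn_sigma_finite n).

Lemma lebesgue_measure_Rn_box n (A : 'I_n -> set (measurableTypeR R)) :
  (forall i, measurable (A i)) ->
  lebesgue_measure_Rn [set t : Rn R n | forall i, A i (tnth t i)] =
  \prod_(i < n) lebesgue_measure (A i).
Proof.
elim: n A => [|n IHn] A mA.
  by rewrite big_ord0 /= diracE mem_set//= => -[].
rewrite big_ord_recl /= /pushforward.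
rewrite -(IHn (fun i => A (lift ord0 i)))//.
rewrite -product_measure1E//; last first.
  rewrite (_ : [set _ | _] =
    \bigcap_(i in [set: 'I_n]) ((@tnth n _)^~ i @^-1` A (lift ord0 i))); last first.
    by apply/seteqP; split => t /= h i; [move=> _; exact: h|exact: (h i I)].
  apply: fin_bigcap_measurable => // i _.
  by rewrite -[X in measurable X]setTI; exact: measurable_tnth.
congr (_ _); apply/seteqP; split => -[x t] /= => [h|[h0 h] i].
  by split=> [|i]; [exact: (h ord0)|have := h (lift ord0 i); rewrite tnthS].
by case: (unliftP ord0 i) => [j ->|-> //]; rewrite tnthS; exact: h.
Qed.

End lebesgue_measure_Rn.

Definition dotp {R : realType} {p : nat} (theta : 'rV[R]_p) (t : Rn R p) : R :=
  \sum_(i < p) theta 0 i * (tnth t i : R).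

Section exponential_family.
Context {R : realType} {k p : nat}.
Variables (T : Rn R k -> Rn R p) (h : Rn R k -> R).
Local Notation mu := (@lebesgue_measure_Rn R k).

Definition log_normalizer (theta : 'rV[R]_p) : \bar R :=
  lne (\int[mu]_x (expR (dotp theta (T x)) * h x)%:E).

(* [fine] is only applied to a finite value when [h] is nonnegative and not
   almost everywhere zero, since then [log_normalizer theta != -oo]. *)
Definition expfam_density (theta : 'rV[R]_p) (x : Rn R k) : R :=
  if log_normalizer theta == +oo%E then 0
  else expR (dotp theta (T x) - fine (log_normalizer theta)) * h x.

Variables (f phi : Rn R k -> R).

Definition target_integral : R := \int[mu]_x (phi x * f x).

(* Division by zero is zero in [R], so the integrand vanishes wherever
   [phi x * f x = 0], even if the density is zero there. *)
Definition importance_variance (theta : 'rV[R]_p) : \bar R :=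
  if log_normalizer theta == +oo%E then +oo%E
  else (\int[mu]_x (phi x ^+ 2 * f x ^+ 2 / expfam_density theta x)%:E
        - (target_integral ^+ 2)%:E)%E.

End exponential_family.

(* Main.v *)
(* The exponential is convex, so the product
   f_theta1^eta f_theta2^(1 - eta) is pointwise at most
   eta f_theta1 + (1 - eta) f_theta2; integrating this gives the convexity of
   the log-normalizer A without Hoelder's inequality.  Where A is finite, the
   variance integrand is phi^2 f^2 / h * exp (A theta - theta^T T), and
   A theta - theta^T T is convex in theta, hence so is its exponential, and
   the inequality can be integrated once more.  Where A is infinite at an
   endpoint of positive weight, the right-hand side is +oo. *)
Require Import Defs.
From mathcomp Require Import all_boot all_order all_algebra.
From mathcomp Require Import all_classical all_reals all_analysis.
From mathcomp Require Import measurable_realfun ring.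
Import Order.TTheory GRing.Theory Num.Theory.
Import numFieldNormedType.Exports.
Local Open Scope classical_set_scope.
Local Open Scope ring_scope.

(** * Convexity of the exponential, and integration of convex bounds *)

Lemma expR_convex {R : realType} {eta : R} (a b : R) : 0 <= eta <= 1 ->
  expR (eta * a + (1 - eta) * b) <= eta * expR a + (1 - eta) * expR b.
Proof.
move=> /andP[e0 e1].
pose t : {i01 R} := Itv01 e0 e1.
have := convex_expR t a b.
by rewrite !convRE.
Qed.

(** Used in both directions: with [a] the pairing with [T] and [c] the log-normalizer for densities,
    and with the two roles exchanged for their reciprocals. *)
Lemma expR_convexB {R : realType} {eta : R} (a1 a2 c1 c2 : R) :
  0 <= eta <= 1 ->
  expR (eta * a1 + (1 - eta) * a2 - (eta * c1 + (1 - eta) * c2)) <=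
  eta * expR (a1 - c1) + (1 - eta) * expR (a2 - c2).
Proof.
move=> /(expR_convex (a1 - c1) (a2 - c2)).
by rewrite !mulrBr opprD addrACA.
Qed.

Lemma dotp_linear {R : realType} {p : nat} (a b : R) (u v : 'rV[R]_p) t :
  dotp (a *: u + b *: v) t = a * dotp u t + b * dotp v t.
Proof.
rewrite /dotp !mulr_sumr -big_split /=; apply: eq_bigr => i _.
by rewrite !mxE mulrDl !mulrA.
Qed.

Lemma measurable_dotp {R : realType} {d} {X : measurableType d} {p : nat}
    (theta : 'rV[R]_p) (T : X -> Rn R p) :
  measurable_fun setT T -> measurable_fun setT (fun x => dotp theta (T x)).
Proof.
move=> mT; apply: measurable_sum => i; apply: measurable_funM => //.
exact: measurableT_comp (measurable_tnth i) mT.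
Qed.

(** For nonnegative integrands linearity needs no integrability, so the integrals may be infinite,
    as a variance may be. *)
Lemma ge0_le_integral_conv {d} {X : measurableType d} {R : realType}
    (mu : {measure set X -> \bar R}) {eta : R} {g g1 g2 : X -> R} :
  0 <= eta <= 1 ->
  measurable_fun setT (EFin \o g) -> measurable_fun setT (EFin \o g1) ->
  measurable_fun setT (EFin \o g2) ->
  (forall x, 0 <= (g x)%:E)%E -> (forall x, 0 <= (g1 x)%:E)%E ->
  (forall x, 0 <= (g2 x)%:E)%E ->
  (forall x, g x <= eta * g1 x + (1 - eta) * g2 x) ->
  (\int[mu]_x (g x)%:E <=
   eta%:E * \int[mu]_x (g1 x)%:E + (1 - eta)%:E * \int[mu]_x (g2 x)%:E)%E.
Proof.
move=> /andP[e0 e1] mg mg1 mg2 g0 g10 g20 le_g.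
have e1' : 0 <= 1 - eta by rewrite subr_ge0.
have cg1 x : (0 <= eta%:E * (g1 x)%:E)%E by rewrite mule_ge0.
have cg2 x : (0 <= (1 - eta)%:E * (g2 x)%:E)%E by rewrite mule_ge0.
have mcg1 := measurable_funeM eta%:E mg1.
have mcg2 := measurable_funeM (1 - eta)%:E mg2.
rewrite -(ge0_integralZl_EFin _ measurableT (fun x _ => g10 x) mg1 e0).
rewrite -(ge0_integralZl_EFin _ measurableT (fun x _ => g20 x) mg2 e1').
rewrite -(ge0_integralD _ measurableT (fun x _ => cg1 x) mcg1
  (fun x _ => cg2 x) mcg2).
apply: ge0_le_integral => //; first exact: emeasurable_funD mcg1 mcg2.
by move=> x _; rewrite -!EFinM -EFinD lee_fin.
Qed.

(** The weights add up to 1; being positive, they make both sides [+oo] as soon as [x] or [y] is. *)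
Lemma conv_subr_EFin {R : realType} {eta : R} (x y : \bar R) (c : R) :
  0 < eta < 1 -> (0 <= x)%E -> (0 <= y)%E ->
  (eta%:E * (x - c%:E) + (1 - eta)%:E * (y - c%:E) =
   eta%:E * x + (1 - eta)%:E * y - c%:E)%E.
Proof.
move=> /andP[e0]; rewrite -subr_gt0 => e1.
case: x y => [x| |] [y| |]//= _ _; rewrite ?gt0_muley ?lte_fin//.
by rewrite -!(EFinM, EFinD, EFinB); congr EFin; ring.
Qed.

(** * The normalizer and convexity of its logarithm *)

Section expfam_convexity.
Context {R : realType} {k p : nat}.
Variables (h : Rn R k -> R) (T : Rn R k -> Rn R p).
Hypotheses (mh : measurable_fun [set: Rn R k] h)
  (mT : measurable_fun [set: Rn R k] T) (h_ge0 : forall x, 0 <= h x)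
  (h_neq0 : ~ {ae @lebesgue_measure_Rn R k, forall x, h x = 0}).
Local Notation mu := (@lebesgue_measure_Rn R k).
Local Notation A := (log_normalizer T h).

(** The shift [c] is free: 0 gives the integrand of the normalizer, [fine (A theta)] the density. *)
Let measurable_weight (theta : 'rV[R]_p) (c : R) :
  measurable_fun [set: Rn R k] (fun x => (expR (dotp theta (T x) - c) * h x)%:E).
Proof.
apply/measurable_EFinP; apply: measurable_funM => //.
apply: measurableT_comp => //; apply: measurable_funB => //.
exact: measurable_dotp.
Qed.

Let weight_ge0 (theta : 'rV[R]_p) (c : R) x :
  (0 <= (expR (dotp theta (T x) - c) * h x)%:E)%E.
Proof. by rewrite lee_fin mulr_ge0 ?expR_ge0. Qed.

Lemma integral_weight_shift (theta : 'rV[R]_p) (c : R) :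
  (\int[mu]_x (expR (dotp theta (T x) - c) * h x)%:E =
   (expR (- c))%:E * \int[mu]_x (expR (dotp theta (T x)) * h x)%:E)%E.
Proof.
have := measurable_weight theta 0; have := weight_ge0 theta 0.
under eq_fun do rewrite subr0.
move=> w0 mw.
rewrite -ge0_integralZl_EFin ?expR_ge0//; last by move=> x _; have := w0 x; rewrite subr0.
by apply: eq_integral => x _; rewrite -EFinM addrC expRD mulrA.
Qed.

(** The exponential never vanishes, so a zero integral would force [h] to be zero almost
    everywhere. *)
Lemma normalizer_gt0 (theta : 'rV[R]_p) :
  (0 < \int[mu]_x (expR (dotp theta (T x)) * h x)%:E)%E.
Proof.
have := measurable_weight theta 0.
under eq_fun do rewrite subr0.
move=> mw; rewrite lt_neqAle integral_ge0 ?andbT; last first.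
  by move=> x _; rewrite lee_fin mulr_ge0 ?expR_ge0.
apply/eqP => /esym Z0; apply: h_neq0.
have /(ae_eq_integral_abs mu measurableT mw) :
    (\int[mu]_x `|(expR (dotp theta (T x)) * h x)%:E| = 0)%E.
  rewrite -[RHS]Z0; apply: eq_integral => x _.
  by rewrite gee0_abs// lee_fin mulr_ge0 ?expR_ge0.
apply: filterS => x /(_ I) [] /eqP.
by rewrite mulf_eq0 gt_eqF ?expR_gt0//= => /eqP.
Qed.

Lemma log_normalizerK (theta : 'rV[R]_p) : A theta != +oo%E ->
  (\int[mu]_x (expR (dotp theta (T x)) * h x)%:E =
   (expR (fine (A theta)))%:E)%E.
Proof.
have := normalizer_gt0 theta; rewrite /log_normalizer.
case: (\int[mu]_x _)%E => [z| |]//; rewrite lte_fin => z0 _.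
by rewrite lne_EFin//= lnK.
Qed.

Lemma integral_expfam (theta : 'rV[R]_p) : A theta != +oo%E ->
  (\int[mu]_x (expR (dotp theta (T x) - fine (A theta)) * h x)%:E = 1)%E.
Proof.
move=> Afin; rewrite integral_weight_shift log_normalizerK//.
by rewrite -EFinM -expRD addNr expR0.
Qed.

Lemma log_normalizer_convex (eta : R) (theta1 theta2 : 'rV[R]_p) :
  0 <= eta <= 1 -> A theta1 != +oo%E -> A theta2 != +oo%E ->
  (A (eta *: theta1 + (1 - eta) *: theta2) <=
   (eta * fine (A theta1) + (1 - eta) * fine (A theta2))%:E)%E.
Proof.
move=> eta01 A1 A2.
have w1_ge0 := weight_ge0 theta1 (fine (A theta1)).
have w2_ge0 := weight_ge0 theta2 (fine (A theta2)).
have mw1 := measurable_weight theta1 (fine (A theta1)).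
have mw2 := measurable_weight theta2 (fine (A theta2)).
set theta := _ + _; set c := _ + _.
(* The bound 1 is the convex combination of the total masses of the two densities. Pulling
   [expR (- c)] out of the integral then bounds the normalizer at [theta] by [expR c]. *)
have le1 : (\int[mu]_x (expR (dotp theta (T x) - c) * h x)%:E <= 1)%E.
  have int1 := integral_expfam _ A1; have int2 := integral_expfam _ A2.
  have <- : (eta%:E * 1 + (1 - eta)%:E * 1 = 1 :> \bar R)%E.
    by rewrite !mule1 -EFinD addrC subrK.
  rewrite -{1}int1 -int2.
  apply: (ge0_le_integral_conv mu eta01 (measurable_weight theta c) mw1 mw2
    (weight_ge0 theta c) w1_ge0 w2_ge0) => x.
  rewrite !mulrA -mulrDl ler_wpM2r//.
  by rewrite /theta /c dotp_linear expR_convexB.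
move: le1; rewrite integral_weight_shift /log_normalizer.
have := normalizer_gt0 theta.
case: (\int[mu]_x _)%E => [z| |]//; last first.
  by rewrite gt0_muley// lte_fin expR_gt0.
rewrite lte_fin => z0; rewrite lne_EFin// -EFinM !lee_fin.
rewrite expRN mulrC ler_pdivrMr ?expR_gt0// mul1r => zc.
by rewrite -ler_expR lnK.
Qed.

(** * Convexity of the variance *)

Variables (f phi : Rn R k -> R).
Hypotheses (mf : measurable_fun [set: Rn R k] f)
  (mphi : measurable_fun [set: Rn R k] phi).
Local Notation I := (target_integral f phi).
Local Notation V := (importance_variance T h f phi).

(** The factor of the variance integrand that is independent of the parameter; it is 0 where [h]
    vanishes. *)
Let G x := phi x ^+ 2 * f x ^+ 2 / h x.

Let G_ge0 x : 0 <= G x.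
Proof. by rewrite /G divr_ge0// mulr_ge0// sqr_ge0. Qed.

Let mG (theta : 'rV[R]_p) (c : R) :
  measurable_fun [set: Rn R k] (fun x => (G x * expR (c - dotp theta (T x)))%:E).
Proof.
apply/measurable_EFinP; apply: measurable_funM.
  apply: measurable_funM.
    by apply: measurable_funM; exact: measurable_funX.
  (* Both [x^-1] and [x `^ (-1)] are 0 at 0. *)
  rewrite (_ : (fun x => (h x)^-1) = (fun x => h x `^ (-1))).
    exact: measurableT_comp (measurable_powR (-1)) mh.
  by apply/funext => x; rewrite powR_inv1.
apply: measurableT_comp => //; apply: measurable_funB => //.
exact: measurable_dotp.
Qed.

Lemma importance_variance_finE (theta : 'rV[R]_p) : A theta != +oo%E ->
  V theta = (\int[mu]_x (G x * expR (fine (A theta) - dotp theta (T x)))%:E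
    - (I ^+ 2)%:E)%E.
Proof.
move=> Afin; rewrite /importance_variance (negbTE Afin); congr (_ - _)%E.
apply: eq_integral => x _; congr EFin.
(* Inversion is multiplicative even at 0, so points where [h] vanishes need no separate case. *)
rewrite /expfam_density (negbTE Afin) /G invfM -expRN opprB.
by rewrite [expR _ * _]mulrC mulrA.
Qed.

(** Keeps [+oo] from meeting [-oo] in the convex combination of variances. *)
Lemma importance_variance_gtNy (theta : 'rV[R]_p) : (-oo < V theta)%E.
Proof.
have [Ay|Afin] := eqVneq (A theta) +oo%E.
  by rewrite /importance_variance Ay eqxx.
rewrite importance_variance_finE//.
have : (0 <= \int[mu]_x (G x * expR (fine (A theta) - dotp theta (T x)))%:E)%E.
  by apply: integral_ge0 => x _; rewrite lee_fin mulr_ge0 ?expR_ge0.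
by case: (\int[mu]_x _)%E => [z| |]//= _; rewrite ltNyr.
Qed.

Lemma importance_variance_convex (eta : R) (theta1 theta2 : 'rV[R]_p) :
  0 <= eta <= 1 ->
  (V (eta *: theta1 + (1 - eta) *: theta2)
    <= eta%:E * V theta1 + (1 - eta)%:E * V theta2)%E.
Proof.
move=> eta01; have /andP[] := eta01.
(* The extreme values of [eta] are treated apart: there a possibly infinite variance has weight 0
   and contributes 0. *)
rewrite le_eqVlt => /predU1P[<- _|e0].
  by rewrite scale0r mul0e subr0 scale1r mul1e !add0r.
rewrite le_eqVlt => /predU1P[->|e1].
  by rewrite subrr scale0r mul0e scale1r mul1e !addr0.
have e1' : 0 < 1 - eta by rewrite subr_gt0.
have gtNy c theta : 0 < c -> (c%:E * V theta)%E != -oo%E.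
  move=> c0; rewrite -ltNye.
  have := importance_variance_gtNy theta.
  case: (V theta) => [v| |]//= _; first by rewrite -EFinM ltNyr.
  by rewrite gt0_muley ?lte_fin.
have [A1|A1] := eqVneq (A theta1) +oo%E.
  rewrite [X in (_ <= eta%:E * X + _)%E]/importance_variance A1 eqxx.
  by rewrite gt0_muley ?lte_fin// addye ?leey// gtNy.
have [A2|A2] := eqVneq (A theta2) +oo%E.
  rewrite [X in (_ <= _ + (1 - eta)%:E * X)%E]/importance_variance A2 eqxx.
  by rewrite gt0_muley ?lte_fin// addey ?leey// gtNy.
have Aconv := log_normalizer_convex _ _ _ eta01 A1 A2.
set theta := _ + _ in Aconv *.
have Afin : A theta != +oo%E.
  by rewrite -ltey; apply: le_lt_trans Aconv _; rewrite ltry.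
(* Positivity of the normalizer excludes [-oo], at which [fine] would return the default 0. *)
have fA : fine (A theta) <= eta * fine (A theta1) + (1 - eta) * fine (A theta2).
  move: Aconv Afin (normalizer_gt0 theta); rewrite /log_normalizer.
  case: (\int[mu]_x _)%E => [z| |]// + _.
  by rewrite lte_fin => + z0; rewrite lne_EFin//= lee_fin.
rewrite !importance_variance_finE//.
have J0 (theta' : 'rV[R]_p) c x :
    (0 <= (G x * expR (c - dotp theta' (T x)))%:E)%E.
  by rewrite lee_fin mulr_ge0 ?expR_ge0.
rewrite conv_subr_EFin ?integral_ge0 ?e0//.
apply: leeB => //; apply: (ge0_le_integral_conv mu eta01
  (mG theta (fine (A theta))) (mG theta1 (fine (A theta1)))
  (mG theta2 (fine (A theta2))) (J0 _ _) (J0 _ _) (J0 _ _)) => x.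
rewrite !(mulrCA _ (G x)) -mulrDr ler_wpM2l//.
(* After cancelling [G x], [fA] enlarges the exponent to the convex combination on which the
   exponential is then split. *)
apply: le_trans (expR_convexB _ _ _ _ eta01).
by rewrite ler_expR /theta dotp_linear lerB.
Qed.
End expfam_convexity.

Theorem theorem1 (R : realType) (k p : nat)
    (f phi h : Rn R k -> R) (T : Rn R k -> Rn R p)
    (mf : measurable_fun [set: Rn R k] f)
    (mphi : measurable_fun [set: Rn R k] phi)
    (mh : measurable_fun [set: Rn R k] h)
    (mT : measurable_fun [set: Rn R k] T)
    (f_ge0 : forall x, 0 <= f x)
    (f_int1 : (\int[@lebesgue_measure_Rn R k]_x (f x)%:E = 1)%E)
    (phif_integrable :
      (@lebesgue_measure_Rn R k).-integrable [set: Rn R k]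
        (fun x => (phi x * f x)%:E))
    (h_ge0 : forall x, 0 <= h x)
    (h_neq0 : ~ {ae @lebesgue_measure_Rn R k, forall x, h x = 0})
    (h_gt0 : forall x, phi x * f x != 0 -> 0 < h x)
    (Theta : set 'rV[R]_p) (Theta_convex : convex_set Theta)
    (eta : R) (eta01 : 0 <= eta <= 1)
    (theta1 theta2 : 'rV[R]_p)
    (Theta1 : Theta theta1) (Theta2 : Theta theta2) :
  (importance_variance T h f phi (eta *: theta1 + (1 - eta) *: theta2)
    <= eta%:E * importance_variance T h f phi theta1
       + (1 - eta)%:E * importance_variance T h f phi theta2)%E.
Proof. exact: importance_variance_convex. Qed.
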